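(* There exist a constant $c_0\in(0,1)$ and a 1-sided error, nonadaptive, $t$-online-erasure-resilient $\varepsilon$-tester for linearity of functions $f:\{0,1\}^d\to\{0,1\}$ that is correct whenever $t\le c_0\cdot\varepsilon\cdot 2^{d/4}$ and makes $O(t/\varepsilon)$ queries.
   Context: Online-erasure model. An input is a function $f:D\to R$ on a finite domain $D$. An algorithm accesses $f$ only through an oracle $\mathcal{O}$ by querying points $x\in D$ one at a time and receiving $\mathcal{O}(x)$. Initially $\mathcal{O}(x)=f(x)$ for all $x\in D$. For $t\in\mathbb{N}$, a $t$-online-erasure oracle, after answering each query, may choose up to $t$ points $x\in D$ and set $\mathcal{O}(x)=\perp$ (a special ''erased'' symbol); these values are used to answer all future queries. The choice of erasures (the adversarial strategy) may depend on $f$, on the queries and answers so far, and on the algorithm's code, but not on the algorithm's future random coins; the algorithm does not know where erasures are. A property $\mathcal{P}$ is a set of functions; $f$ is $\varepsilon$-far from $\mathcal{P}$ if for every $g\in\mathcal{P}$, $f$ and $g$ differ on at least an $\varepsilon$ fraction of $D$. A $t$-online-erasure-resilient $\varepsilon$-tester for $\mathcal{P}$ is a randomized algorithm that, given $t,\varepsilon$ and access to $f$ via a $t$-online-erasure oracle, for every adversarial strategy accepts with probability at least $2/3$ if $f\in\mathcal{P}$ and rejects with probability at least $2/3$ if $f$ is $\varepsilon$-far from $\mathcal{P}$. It has 1-sided error if it accepts every $f\in\mathcal{P}$ with probability 1; it is nonadaptive if its queries do not depend on answers to previous queries. A function $f:\{0,1\}^d\to\{0,1\}$ is linear if there is $S\subseteq[d]$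 with $f(x)=\sum_{i\in S}x[i]\bmod 2$ for all $x$. *)

(* Defs.v *)
From HB Require Import structures.
From mathcomp Require Import all_boot all_order all_algebra.
From mathcomp Require Import reals exp.
Set Implicit Arguments. Unset Strict Implicit. Unset Printing Implicit Defensive.
Import Order.TTheory GRing.Theory Num.Theory.
Local Open Scope ring_scope.

Notation cube d := {ffun 'I_d -> bool}.

Definition is_linear (d : nat) (f : cube d -> bool) : Prop :=
  exists S : {set 'I_d}, forall x : cube d, f x = \big[addb/false]_(i in S) x i.

Definition lin_far (R : realType) (d : nat) (eps : R) (f : cube d -> bool) : Prop :=
  forall g : cube d -> bool, is_linear g ->
    eps <= #|[set x : cube d | f x != g x]|%:R / #|{: cube d}|%:R.

(* A randomized NONADAPTIVE algorithm: random coins drawn uniformly from a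
   finite type; the nq queries are a function of the coins only; the output
   is a function of the coins and of the answers received (None = erased). *)
Record na_algo (d : nat) := NAAlgo {
  coins : finType;
  nq : nat;
  query : coins -> 'I_nq -> cube d;
  decide : coins -> seq (option bool) -> bool }.

(* A history is the list of (query, answer) pairs so far.
   A (deterministic) adversary maps the history (after each answer) to the
   set of points it erases at that moment. *)
Definition history d := seq (cube d * option bool).
Definition adversary d := history d -> {set cube d}.

Definition adv_budget d (t : nat) (adv : adversary d) : Prop :=
  forall h : history d, (#|adv h| <= t)%N.

Fixpoint run_oracle d (f : cube d -> bool) (adv : adversary d)
  (qs : seq (cube d)) (E : {set cube d}) (h : history d) : history d :=
  match qs with
  | [::] => h
  | x :: qs' =>
      let a := if x \in E then None else Some (f x) in
      let h' := rcons h (x, a) in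
      run_oracle f adv qs' (E :|: adv h') h'
  end.

Definition queries d (A : na_algo d) (r : coins A) : seq (cube d) :=
  [seq query r i | i <- enum 'I_(nq A)].

Definition answers d (A : na_algo d) (f : cube d -> bool) (adv : adversary d)
  (r : coins A) : seq (option bool) :=
  map snd (run_oracle f adv (queries r) set0 [::]).

Definition acc_prob (R : realType) d (A : na_algo d) (f : cube d -> bool)
  (adv : adversary d) : R :=
  #|[set r : coins A | decide r (answers f adv r)]|%:R / #|{: coins A}|%:R.

Definition oe_lin_tester_1sided (R : realType) d (t : nat) (eps : R)
  (A : na_algo d) : Prop :=
  (forall f : cube d -> bool, is_linear f ->
     forall adv : adversary d, adv_budget t adv -> acc_prob R A f adv = 1) /\
  (forall f : cube d -> bool, lin_far eps f ->
     forall adv : adversary d, adv_budget t adv -> acc_prob R A f adv <= 1/3).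

(* Main.v *)
Require Import Defs.
From HB Require Import structures.
From mathcomp Require Import all_boot all_order all_algebra.
From mathcomp Require Import reals exp.
From mathcomp Require Import perm zify ring lra.
Set Implicit Arguments. Unset Strict Implicit. Unset Printing Implicit Defensive.
Import Order.TTheory GRing.Theory Num.Theory.
Local Open Scope ring_scope.

(** Let [N = 2 ^ d], [m ~ 9 / eps], [k = 100 m max(t, 1)] and [q = m + k].  The
    tester draws [q] independent uniform pairs of points, queries all first halves
    in random order, then all second halves in random order, and finally the sums
    of the first [m] pairs.  It rejects when some fully answered triple violates
    linearity.

    - By the Fourier-analytic BLR argument each pair violates linearity with
      probability at least [eps], so no tested pair does with probability at most
      [(1 - eps) ^ m <= 1 / (1 + m eps) <= 1 / 10].
    - A half is uniform given the previous queries, so some half is erased before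
      it is queried with probability at most [2q * 2qt / N].
    - Two of the [q ^ 2] sums of a first and a second half collide with probability
      at most [q ^ 4 / N].  When they do not, the next sum is uniform, from the
      adversary's point of view, among at least [k ^ 2] distinct candidates, of
      which at most [t (2q + m)] are erased.  The union bound over the [m] sums
      costs [m t (2q + m) / k ^ 2].

    The bound on [t] gives [q ^ 4 << N], so the total stays below [1 / 3].  For
    [t = 0] only the first item is needed. *)

(** * Averaging *)

(** Double counting of the pairs [(w, r)]: each [phi w] permutes the finite type [T], so it
    preserves the number of coins satisfying [P]. The [phi w] will rerandomize coins without
    changing what the adversary has seen. *)
Lemma averaging_bound (T W : finType) (phi : W -> T -> T) (P : pred T) (B : nat) :
  (forall w, injective (phi w)) ->
  (forall r, #|[set w | P (phi w r)]| <= B)%N ->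
  (#|[set r | P r]| * #|W| <= B * #|T|)%N.
Proof.
move=> phi_inj PB.
have -> : (#|[set r | P r]| * #|W| = \sum_(r : T) #|[set w | P (phi w r)]|)%N.
  transitivity (\sum_(w : W) \sum_(r : T) (P (phi w r) : nat))%N.
    rewrite mulnC -sum_nat_const; apply: eq_bigr => w _.
    rewrite -sum1dep_card big_mkcond (reindex_inj (phi_inj w)) /=.
    by apply: eq_bigr => r _; case: (P _).
  rewrite exchange_big; apply: eq_bigr => r _.
  by rewrite -sum1dep_card [RHS]big_mkcond; apply: eq_bigr => w _; case: (P _).
by rewrite mulnC -sum_nat_const; apply: leq_sum.
Qed.

Lemma union_bound (T I : finType) (P : I -> pred T) (b c : nat) :
  (forall i, #|[set r | P i r]| * b <= c)%N ->
  (#|[set r | [exists i, P i r]]| * b <= #|I| * c)%N.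
Proof.
move=> Pb; rewrite -[leqRHS]sum_nat_const.
have cup : [set r | [exists i, P i r]] = \bigcup_i [set r | P i r].
  apply/setP=> r; rewrite inE; apply/existsP/bigcupP => [[i Pir]|[i _]].
    by exists i; rewrite ?inE.
  by rewrite inE => Pir; exists i.
apply: (@leq_trans (\sum_i #|[set r | P i r]| * b)%N); last exact: leq_sum.
rewrite -big_distrl leq_mul2r cup; apply/orP; right.
elim/big_rec2: _ => [|i n A _ IH]; first by rewrite cards0.
by apply: leq_trans (leq_card_setU _ _) _; rewrite leq_add2l.
Qed.

(** * Fourier analysis of the linearity test *)

Lemma cube_oppE d (x : cube d) : - x = x.
Proof. by apply/ffunP=> i; rewrite !ffunE. Qed.

Lemma cube_addK d (x : cube d) : x + x = 0.
Proof. by rewrite -{2}[x]cube_oppE subrr. Qed.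

Lemma cube_addE d (x y : cube d) i : (x + y) i = x i (+) y i.
Proof. by rewrite ffunE. Qed.

Lemma card_cube_gt0 (R : realType) d : 0 < #|{: cube d}|%:R :> R.
Proof. by rewrite ltr0n; apply/card_gt0P; exists 0. Qed.

Definition parity d (S : {set 'I_d}) (x : cube d) : bool :=
  \big[addb/false]_(i in S) x i.

Lemma parityD d (S : {set 'I_d}) (x y : cube d) :
  parity S (x + y) = parity S x (+) parity S y.
Proof.
by rewrite /parity -big_split /=; apply: eq_bigr => i _; rewrite cube_addE.
Qed.

Lemma is_linearD {d} {f : cube d -> bool} (x y : cube d) :
  is_linear f -> f (x + y) = f x (+) f y.
Proof. by case=> S fS; rewrite !fS -!/(parity _ _) parityD. Qed.

Definition violates d (f : cube d -> bool) (p : cube d * cube d) : bool :=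
  f (p.1 + p.2) != f p.1 (+) f p.2.

Section LinearityTest.
Variables (R : realType) (d : nat).
Implicit Types (S : {set 'I_d}) (x y z : cube d).

Definition chi (S : {set 'I_d}) (x : cube d) : R := (-1) ^+ parity S x.

Lemma chiD S x y : chi S (x + y) = chi S x * chi S y.
Proof. by rewrite /chi parityD signr_addb. Qed.

Definition flip (i : 'I_d) (S : {set 'I_d}) := [set j | (j \in S) (+) (j == i)].

Lemma flipK i : involutive (flip i).
Proof. by move=> S; apply/setP=> j; rewrite !inE -addbA addbb addbF. Qed.

Lemma chi_flip i S x : x i -> chi (flip i S) x = - chi S x.
Proof.
move=> xi; rewrite /chi.
suff -> : parity (flip i S) x = parity S x (+) true.
  by rewrite signr_addb expr1 mulrN1.
rewrite /parity big_mkcond [in RHS]big_mkcond /=.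
rewrite (bigD1 i) //= [in RHS](bigD1 i) //= !inE eqxx xi.
rewrite (eq_bigr (fun j => if j \in S then x j else false)); last first.
  by move=> j /negbTE ji; rewrite inE ji addbF.
by case: (i \in S); case: (\big[_/_]_(_ | _) _).
Qed.

Lemma card_subsets : #|{: {set 'I_d}}| = #|{: cube d}|.
Proof. by rewrite card_ffun card_bool -[LHS]cardsT -powersetT card_powerset cardsT. Qed.

(** Orthogonality of characters: if [x i] holds, the involution [flip i] negates every term, so the
    sum equals its own opposite. *)
Lemma sum_chi x : \sum_S chi S x = if x == 0 then #|{: cube d}|%:R else 0.
Proof.
case: eqP => [->|/eqP x0].
  rewrite (eq_bigr (fun=> 1)); last first.
    by move=> S _; rewrite /chi /parity big1 // => i _; rewrite ffunE.
  by rewrite sumr_const card_subsets.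
have /existsP[i xi] : [exists i, x i].
  apply: contraNT x0 => /existsPn xF; apply/eqP/ffunP=> i.
  by rewrite ffunE (negbTE (xF i)).
suff: \sum_S chi S x = - \sum_S chi S x by lra.
rewrite {1}(reindex_inj (inv_inj (flipK i))) /= -sumrN.
by apply: eq_bigr => S _; rewrite chi_flip.
Qed.

Variables (f : cube d -> bool).
Let N : R := #|{: cube d}|%:R.
Let F x : R := (-1) ^+ f x.

(** Unnormalized: [N] times the usual coefficient of the sign function [F], hence the powers of [N]
    below. *)
Definition fourier S : R := \sum_x F x * chi S x.

Lemma sum_sign (T : finType) (P : pred T) :
  \sum_p (-1) ^+ P p = #|T|%:R - 2 * #|[set p | P p]|%:R :> R.
Proof.
have -> : #|T|%:R = \sum_(p : T) 1 :> R by rewrite sumr_const.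
rewrite -sum1dep_card natr_sum [X in 2 * X]big_mkcond /= mulr_sumr -sumrB.
by apply: eq_bigr => p _; case: (P p) => /=; rewrite ?expr1 ?expr0; lra.
Qed.

Lemma fourier_dist S : fourier S = N - 2 * #|[set x | f x != parity S x]|%:R.
Proof.
rewrite -sum_sign; apply: eq_bigr => x _; rewrite /F /chi -signr_addb.
by case: (f x); case: (parity S x).
Qed.

(** Parseval: after expanding the square, orthogonality keeps only [y = x]. *)
Lemma sum_fourier2 : \sum_S fourier S ^+ 2 = N ^+ 2.
Proof.
transitivity (\sum_x \sum_y F x * F y * \sum_S chi S (x + y)).
  under eq_bigr => S _ do rewrite expr2 mulr_suml.
  rewrite exchange_big /=; apply: eq_bigr => x _.
  under eq_bigr => S _ do rewrite mulr_sumr.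
  rewrite exchange_big /=; apply: eq_bigr => y _.
  rewrite mulr_sumr; apply: eq_bigr => S _; rewrite chiD; ring.
transitivity (\sum_(x : cube d) N); last first.
  by rewrite sumr_const -mulr_natr expr2.
apply: eq_bigr => x _; rewrite (bigD1 x) //= sum_chi cube_addK eqxx big1 => [|y yx].
  by rewrite addr0 /F -signr_addb addbb expr0 mul1r.
by rewrite sum_chi -[x in x + _]cube_oppE addrC subr_eq0 (negbTE yx) mulr0.
Qed.

(** In the expanded cube, orthogonality keeps only [z = x + y], the triples of the linearity
    test. *)
Lemma sum_fourier3 :
  \sum_S fourier S ^+ 3 = N * \sum_x \sum_y F x * F y * F (x + y).
Proof.
transitivity (\sum_x \sum_y \sum_z F x * F y * F z * \sum_S chi S (x + y + z)).
  under eq_bigr => S _ do rewrite exprS expr2 mulr_suml.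
  rewrite exchange_big /=; apply: eq_bigr => x _.
  under eq_bigr => S _ do rewrite mulr_suml mulr_sumr.
  rewrite exchange_big /=; apply: eq_bigr => y _.
  under eq_bigr => S _ do rewrite !mulr_sumr.
  rewrite exchange_big /=; apply: eq_bigr => z _.
  rewrite mulr_sumr; apply: eq_bigr => S _; rewrite !chiD; ring.
rewrite mulr_sumr; apply: eq_bigr => x _; rewrite mulr_sumr; apply: eq_bigr => y _.
rewrite (bigD1 (x + y)) //= sum_chi cube_addK eqxx big1 => [|z zxy].
  by rewrite addr0 mulrC.
by rewrite sum_chi -[X in _ + X]cube_oppE subr_eq0 eq_sym (negbTE zxy) mulr0.
Qed.

(** Farness bounds every coefficient by [(1 - 2 eps) N], so the cubes sum to at most this times the
    sum of squares. The triple correlation is [N ^ 2] minus twice the number of violating pairs. *)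
Lemma violation_rate (eps : R) :
  lin_far eps f -> eps * N ^+ 2 <= #|[set p | violates f p]|%:R.
Proof.
move=> far; have N0 : 0 < N := card_cube_gt0 R d.
have fourier_le S : fourier S <= N - 2 * (eps * N).
  rewrite fourier_dist lerD2l lerN2 ler_pM2l // -ler_pdivlMr //.
  by apply: far; exists S.
have: N * \sum_x \sum_y F x * F y * F (x + y) <= (N - 2 * (eps * N)) * N ^+ 2.
  rewrite -sum_fourier3 -sum_fourier2 mulr_sumr; apply: ler_sum => S _.
  by rewrite exprS ler_wpM2r ?sqr_ge0.
have -> : \sum_x \sum_y F x * F y * F (x + y) =
          N ^+ 2 - 2 * #|[set p | violates f p]|%:R.
  have -> : N ^+ 2 = #|{: cube d * cube d}|%:R by rewrite card_prod natrM expr2.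
  rewrite -sum_sign (pair_big xpredT xpredT (fun x y => F x * F y * F (x + y))) /=.
  apply: eq_bigr => -[x y] _; rewrite /violates /F /= -!signr_addb.
  by case: (f x); case: (f y); case: (f (x + y)).
have -> : (N - 2 * (eps * N)) * N ^+ 2 = N * (N ^+ 2 - 2 * (eps * N ^+ 2)) by ring.
rewrite ler_pM2l //; lra.
Qed.

End LinearityTest.

(** * Erasure oracles *)

Section Oracle.
Variables (d : nat) (f : cube d -> bool) (adv : adversary d).

(** Follows the recursion of [run_oracle] but keeps the erased set, which the history does not
    record. *)
Fixpoint erased_from (qs : seq (cube d)) (E : {set cube d}) (h : history d) :=
  if qs is x :: qs' then
    let h' := rcons h (x, if x \in E then None else Some (f x)) in
    erased_from qs' (E :|: adv h') h'
  else E.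

Definition erased qs := erased_from qs set0 [::].

Lemma size_run_oracle qs E h :
  size (run_oracle f adv qs E h) = (size h + size qs)%N.
Proof.
by elim: qs E h => [|x qs IH] E h /=; rewrite ?addn0 // IH size_rcons addSnnS.
Qed.

Lemma run_oracle_nth x0 qs E h k : (k < size qs)%N ->
  nth (x0, None) (run_oracle f adv qs E h) (size h + k) =
  (nth x0 qs k, if nth x0 qs k \in erased_from (take k qs) E h then None
                else Some (f (nth x0 qs k))).
Proof.
elim: qs E h k => [//|x qs IH] E h [_|k] /=; last first.
  by rewrite ltnS => kq; rewrite -IH // size_rcons addSnnS.
(* Later queries only append to the history. *)
have stable : forall qs' E' h' i, (i < size h')%N ->
    nth (x0, None) (run_oracle f adv qs' E' h') i = nth (x0, None) h' i.
  elim=> [//|y qs' IH'] E' h' i ih /=.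
  by rewrite IH' ?size_rcons ?ltnS 1?ltnW // nth_rcons ih.
by rewrite stable ?size_rcons addn0 ?ltnSn // nth_rcons ltnn eqxx.
Qed.

Lemma nth_answers x0 qs k : (k < size qs)%N ->
  nth None (map snd (run_oracle f adv qs set0 [::])) k =
  if nth x0 qs k \in erased (take k qs) then None else Some (f (nth x0 qs k)).
Proof.
move=> kq; rewrite (nth_map (x0, None)) ?size_run_oracle //.
by have := run_oracle_nth x0 set0 [::] kq; rewrite add0n => ->.
Qed.

Lemma card_erased t qs : adv_budget t adv -> (#|erased qs| <= t * size qs)%N.
Proof.
move=> advt; rewrite /erased.
suff H E h : (#|erased_from qs E h| <= #|E| + t * size qs)%N.
  by rewrite (leq_trans (H _ _)) ?cards0.
elim: qs E h => [|x qs IH] E h /=; first by rewrite muln0 addn0.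
apply: leq_trans (IH _ _) _; rewrite mulnS addnA leq_add2r.
by apply: leq_trans (leq_card_setU _ _) _; rewrite leq_add2l.
Qed.

End Oracle.

(** * The tester *)

Lemma take_eq_nth (T : Type) (x0 : T) (s1 s2 : seq T) n :
  size s1 = size s2 -> (forall i, (i < n)%N -> nth x0 s1 i = nth x0 s2 i) ->
  take n s1 = take n s2.
Proof.
move=> s12 eq12; apply: (@eq_from_nth _ x0); first by rewrite !size_take s12.
move=> i ilt; have i_n : (i < n)%N.
  by apply: leq_trans ilt _; rewrite size_take; case: ltnP => // /ltnW.
by rewrite !nth_take // eq12.
Qed.

Section Tester.
Variables (d m k : nat).
Local Notation q := (m + k)%N.

(* Drawing the pairs first and shuffling their halves by two permutations makes
   the tested pairs [U s], [s < m], independent, while the order of the first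
   [2 * q] queries reveals nothing about which halves belong together. *)
Definition tcoins : finType :=
  ({ffun 'I_q -> cube d * cube d} * {perm 'I_q} * {perm 'I_q})%type.

Implicit Types (r : tcoins) (s : 'I_m) (i j : 'I_q).

Definition pt1 r i : cube d := (r.1.1 i).1.
Definition pt2 r i : cube d := (r.1.1 i).2.

Definition tqueries r : seq (cube d) :=
  [seq pt1 r (r.1.2 i) | i <- enum 'I_q] ++
  [seq pt2 r (r.2 j) | j <- enum 'I_q] ++
  [seq pt1 r (lshift k s) + pt2 r (lshift k s) | s <- enum 'I_m].

(** Position [n] asks for the pair with index [r.1.2 n], so pair [i] is asked at the inverse image
    of [i]. *)
Definition pos1 r i : nat := (r.1.2^-1)%g i.
Definition pos2 r i : nat := (q + (r.2^-1)%g i)%N.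
Definition pos3 s : nat := (q + q + s)%N.

(** A triple with an erased answer is inconclusive, never a reason to reject; this gives 1-sided
    error. *)
Definition caught r (ans : seq (option bool)) s : bool :=
  match nth None ans (pos1 r (lshift k s)), nth None ans (pos2 r (lshift k s)),
        nth None ans (pos3 s) with
  | Some a, Some b, Some c => c != a (+) b
  | _, _, _ => false
  end.

Definition tester : na_algo d :=
  @NAAlgo d tcoins (q + q + m) (fun r (n : 'I_(q + q + m)) => nth 0 (tqueries r) n)
    (fun r ans => [forall s, ~~ caught r ans s]).

Lemma size_tqueries r : size (tqueries r) = (q + q + m)%N.
Proof. by rewrite !size_cat !size_map -!enumT !size_enum_ord addnA. Qed.

Lemma queries_tester r : @queries d tester r = tqueries r.
Proof.
apply: (@eq_from_nth _ 0); first by rewrite size_map size_enum_ord size_tqueries.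
move=> i; rewrite size_map size_enum_ord => iq.
by rewrite (nth_map (Ordinal iq)) ?size_enum_ord //= nth_enum_ord.
Qed.

Lemma nth_tqueries1 r (i : 'I_q) : nth 0 (tqueries r) i = pt1 r (r.1.2 i).
Proof.
rewrite nth_cat size_map size_enum_ord ltn_ord.
by rewrite (nth_map i) ?size_enum_ord // nth_ord_enum.
Qed.

Lemma nth_tqueries2 r (j : 'I_q) : nth 0 (tqueries r) (q + j) = pt2 r (r.2 j).
Proof.
rewrite nth_cat size_map size_enum_ord ltnNge leq_addr addKn /=.
rewrite nth_cat size_map size_enum_ord ltn_ord.
by rewrite (nth_map j) ?size_enum_ord // nth_ord_enum.
Qed.

Lemma nth_tqueries3 r s :
  nth 0 (tqueries r) (pos3 s) = pt1 r (lshift k s) + pt2 r (lshift k s).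
Proof.
rewrite /pos3 -addnA nth_cat size_map size_enum_ord ltnNge leq_addr addKn /=.
rewrite nth_cat size_map size_enum_ord ltnNge leq_addr addKn /=.
by rewrite (nth_map s) ?size_enum_ord // nth_ord_enum.
Qed.

Lemma nth_pos1 r i : nth 0 (tqueries r) (pos1 r i) = pt1 r i.
Proof. by rewrite nth_tqueries1 permKV. Qed.

Lemma nth_pos2 r i : nth 0 (tqueries r) (pos2 r i) = pt2 r i.
Proof. by rewrite nth_tqueries2 permKV. Qed.

(** * Acceptance and lost queries *)

Variables (f : cube d -> bool) (adv : adversary d) (t : nat).
Hypothesis advt : adv_budget t adv.

Definition lost r n : bool := nth 0 (tqueries r) n \in erased f adv (take n (tqueries r)).

Lemma nth_tester_answers r n : (n < q + q + m)%N ->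
  nth None (@answers d tester f adv r) n =
  if lost r n then None else Some (f (nth 0 (tqueries r) n)).
Proof.
by move=> nq; rewrite /answers queries_tester (nth_answers _ _ 0) ?size_tqueries.
Qed.

Lemma pos1_lt r i : (pos1 r i < q)%N. Proof. exact: ltn_ord. Qed.
Lemma pos2_lt r i : (pos2 r i < q + q)%N. Proof. by rewrite ltn_add2l. Qed.
Lemma pos3_lt s : (pos3 s < q + q + m)%N. Proof. by rewrite ltn_add2l. Qed.

Lemma caught_answers r s :
  caught r (@answers d tester f adv r) s =
  [&& ~~ lost r (pos1 r (lshift k s)), ~~ lost r (pos2 r (lshift k s)),
      ~~ lost r (pos3 s) & violates f (r.1.1 (lshift k s))].
Proof.
have p1 := pos1_lt r (lshift k s); have p2 := pos2_lt r (lshift k s).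
have p3 := pos3_lt s.
rewrite /caught !nth_tester_answers ?nth_pos1 ?nth_pos2 ?nth_tqueries3; try lia.
by do 3 case: (lost _ _).
Qed.

Lemma tester_complete : is_linear f -> forall r : coins tester,
  decide r (@answers d tester f adv r).
Proof.
move=> flin r; apply/forallP=> s; rewrite caught_answers /violates.
by rewrite (is_linearD _ _ flin) eqxx !andbF.
Qed.

Definition no_violation r := [forall s, ~~ violates f (r.1.1 (lshift k s))].
Definition early_loss r := [exists n : 'I_(q + q), lost r n].
Definition late_loss r := [exists s, lost r (pos3 s)].

Lemma tester_accepts (r : coins tester) : decide r (@answers d tester f adv r) ->
  [|| no_violation r, early_loss r | late_loss r].
Proof.
move=> /forallP acc.
case: (boolP (early_loss r)) => [_|/existsPn ok12]; first by rewrite orbT.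
case: (boolP (late_loss r)) => [_|/existsPn ok3]; first by rewrite !orbT.
rewrite !orbF; apply/forallP=> s; have := acc s; rewrite caught_answers.
have p1 : (pos1 r (lshift k s) < q + q)%N.
  exact: leq_trans (pos1_lt _ _) (leq_addr _ _).
have := ok12 (Ordinal p1) => /= ->.
by have := ok12 (Ordinal (pos2_lt r (lshift k s))) => /= ->; rewrite ok3.
Qed.

Lemma card_erased_take r n :
  (n <= q + q + m)%N -> (#|erased f adv (take n (tqueries r))| <= t * n)%N.
Proof.
by move=> nq; apply: leq_trans (card_erased _ _ advt) _; rewrite size_takel ?size_tqueries.
Qed.

Lemma lost0 r n : t = 0%N -> (n <= q + q + m)%N -> lost r n = false.
Proof.
move=> t0 nq; apply/negbTE; rewrite /lost.
have := card_erased_take r nq; rewrite t0 mul0n leqn0 cards_eq0 => /eqP ->.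
by rewrite inE.
Qed.

(** * Losses among the halves *)

Definition shift (i : 'I_q) (w : cube d * cube d) r : tcoins :=
  ([ffun j => if j == i then r.1.1 j + w else r.1.1 j], r.1.2, r.2).

Lemma shift_inj i w : injective (shift i w).
Proof.
apply: inv_inj => -[[U sg] ta]; rewrite /shift /=; congr (_, _, _).
apply/ffunP=> j; rewrite !ffunE; case: eqP => // _.
by case: (U j) w => [a b] [v w]; rewrite -addrA; congr pair; rewrite /= cube_addK addr0.
Qed.

Lemma pt1_shift i w r j : pt1 (shift i w r) j = if j == i then pt1 r j + w.1 else pt1 r j.
Proof. by rewrite /pt1 ffunE; case: eqP. Qed.

Lemma pt2_shift i w r j : pt2 (shift i w r) j = if j == i then pt2 r j + w.2 else pt2 r j.
Proof. by rewrite /pt2 ffunE; case: eqP. Qed.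

Lemma card_translate (x : cube d) (E : {set cube d}) : #|[set w : cube d | x + w \in E]| = #|E|.
Proof.
rewrite -(card_imset (mem E) (addrI x)); apply: eq_card => w.
rewrite inE; apply/idP/imsetP => [xwE|[y yE ->]].
  by exists (x + w) => //; rewrite addrA cube_addK add0r.
by rewrite addrA cube_addK add0r.
Qed.

(** Translating by [w] the half asked at position [n] makes that query uniform and leaves the
    earlier queries unchanged, hence also the set of at most [t n] points erased so far. *)
Lemma early_lost_bound (n : 'I_(q + q)) :
  (#|[set r | lost r n]| * #|{: cube d}| <= t * (q + q) * #|tcoins|)%N.
Proof.
suff [phi phi_inj phiP] : exists2 phi : cube d -> tcoins -> tcoins,
    forall w, injective (phi w) &
    forall w r, nth 0 (tqueries (phi w r)) n = nth 0 (tqueries r) n + w /\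
      take n (tqueries (phi w r)) = take n (tqueries r).
  apply: (averaging_bound phi_inj) => r.
  rewrite (eq_card (B := [set w | nth 0 (tqueries r) n + w \in
      erased f adv (take n (tqueries r))])) => [|w]; last first.
    by rewrite !inE /lost; have [-> ->] := phiP w r.
  rewrite card_translate; have n_le := ltnW (ltn_ord n).
  apply: leq_trans (card_erased_take _ (leq_trans n_le (leq_addr _ _))) _.
  by rewrite leq_mul2l n_le orbT.
case: (split_ordP n) => i ->.
  exists (fun w r => shift (r.1.2 i) (w, 0) r) => [w|w r].
    (* The translated index depends on [r], but only through a permutation that [shift]
       preserves. *)
    move=> r1 r2 e12; have e : r1.1.2 = r2.1.2 by case: e12.
    by move: e12; rewrite e; apply: shift_inj.
  split; first by rewrite !nth_tqueries1 pt1_shift eqxx.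
  apply: (take_eq_nth (x0 := 0)); first by rewrite !size_tqueries.
  move=> j /= ji; have jq := ltn_trans ji (ltn_ord i).
  rewrite -[j]/(val (Ordinal jq)) !nth_tqueries1 pt1_shift (inj_eq perm_inj).
  by rewrite -val_eqE /= ltn_eqF.
exists (fun w r => shift (r.2 i) (0, w) r) => [w|w r].
  move=> r1 r2 e12; have e : r1.2 = r2.2 by case: e12.
  by move: e12; rewrite e; apply: shift_inj.
split; first by rewrite !nth_tqueries2 pt2_shift eqxx.
apply: (take_eq_nth (x0 := 0)); first by rewrite !size_tqueries.
move=> j /= ji; case: (ltnP j q) => [jq|qj].
  by rewrite -[j]/(val (Ordinal jq)) !nth_tqueries1 pt1_shift addr0; case: eqP.
have jq : (j - q < q)%N by have := ltn_ord i; lia.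
rewrite -(subnKC qj) -[(j - q)%N]/(val (Ordinal jq)) !nth_tqueries2 pt2_shift.
by rewrite (inj_eq perm_inj) -val_eqE /= ltn_eqF //; lia.
Qed.

Lemma early_loss_bound :
  (#|[set r | early_loss r]| * #|{: cube d}| <= (q + q) * (t * (q + q) * #|tcoins|))%N.
Proof.
rewrite -[X in (_ <= X * _)%N]card_ord; apply: union_bound => n.
exact: early_lost_bound.
Qed.

(** * Collisions and losses among the sums *)

Definition psum r (p : 'I_q * 'I_q) := pt1 r p.1 + pt2 r p.2.

Definition collision r :=
  [exists pp : ('I_q * 'I_q) * ('I_q * 'I_q),
    (pp.1 != pp.2) && (psum r pp.1 == psum r pp.2)].

(** Two distinct index pairs differ in some half; translating a half that occurs in only one of the
    two sums makes them equal for at most one [w]. *)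
Lemma collision_bound :
  (#|[set r | collision r]| * #|{: cube d}| <= q * q * (q * q) * #|tcoins|)%N.
Proof.
have -> : (q * q * (q * q) = #|{: ('I_q * 'I_q) * ('I_q * 'I_q)}|)%N.
  by rewrite !card_prod !card_ord.
apply: union_bound => -[[i j] [i' j']]; rewrite -[leqRHS]mul1n.
have one (x y : cube d) : (#|[set w : cube d | (x + w)%R == y]| <= 1)%N.
  rewrite -(cards1 y) -[X in (_ <= X)%N](card_translate x) subset_leq_card //.
  by apply/subsetP=> w; rewrite !inE.
case: (eqVneq i i') => [<-|ii'].
  case: (eqVneq j j') => [<-|jj'].
    by rewrite (_ : [set r | _] = set0) ?cards0 //; apply/setP=> r; rewrite !inE eqxx.
  apply: (@averaging_bound _ _ (fun w => shift j (0, w))) => [w|r]; first exact: shift_inj.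
  apply: leq_trans (one (pt1 r i + pt2 r j) (pt1 r i + pt2 r j')).
  apply: subset_leq_card; apply/subsetP=> w; rewrite !inE => /andP[_].
  rewrite /psum !pt1_shift !pt2_shift /= !addr0 eqxx eq_sym [j' == j]eq_sym (negbTE jj').
  by rewrite !if_same addrA eq_sym.
apply: (@averaging_bound _ _ (fun w => shift i (w, 0))) => [w|r]; first exact: shift_inj.
apply: leq_trans (one (pt1 r i + pt2 r j) (pt1 r i' + pt2 r j')).
apply: subset_leq_card; apply/subsetP=> w; rewrite !inE => /andP[_].
rewrite /psum !pt1_shift !pt2_shift /= !addr0 eqxx [i' == i]eq_sym (negbTE ii').
by rewrite !if_same addrAC.
Qed.

(* Exchanging the halves of the tested pair [s] with halves of untested pairs
   [u], [v], and correcting the permutations accordingly, leaves every query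
   before the [s]-th sum unchanged. *)
Definition swap s (w : 'I_k * 'I_k) r : tcoins :=
  let ts := tperm (lshift k s) (rshift m w.1) in
  let tt := tperm (lshift k s) (rshift m w.2) in
  ([ffun i => ((r.1.1 (ts i)).1, (r.1.1 (tt i)).2)], (r.1.2 * ts)%g, (r.2 * tt)%g).

Lemma swap_inj s w : injective (swap s w).
Proof.
apply: inv_inj => -[[U sg] ta]; rewrite /swap /= -!mulgA !tperm2 !mulg1.
congr (_, _, _); apply/ffunP=> i; rewrite !ffunE /= !tpermK.
by case: (U i).
Qed.

Lemma psum_swap s w r p : psum (swap s w r) p =
  psum r (tperm (lshift k s) (rshift m w.1) p.1, tperm (lshift k s) (rshift m w.2) p.2).
Proof. by rewrite /psum /pt1 /pt2 !ffunE. Qed.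

(** [swap] only permutes the index pairs whose sums are compared. The averaging can therefore be
    restricted to coins without a collision. *)
Lemma collision_swap s w r : collision r -> collision (swap s w r).
Proof.
set ts := tperm (lshift k s) (rshift m w.1).
set tt := tperm (lshift k s) (rshift m w.2).
case/existsP=> -[[i j] [i' j']] /= /andP[ne eq].
apply/existsP; exists ((ts i, tt j), (ts i', tt j')) => /=.
rewrite !psum_swap /= -/ts -/tt !tpermK eq andbT.
apply: contraNneq ne => -[/perm_inj -> /perm_inj ->] //.
Qed.

Lemma take_swap s w r :
  take (pos3 s) (tqueries (swap s w r)) = take (pos3 s) (tqueries r).
Proof.
apply: (take_eq_nth (x0 := 0)); first by rewrite !size_tqueries.
move=> n; rewrite /pos3 => n_lt; case: (ltnP n q) => [nq|qn].
  rewrite -[n]/(val (Ordinal nq)) !nth_tqueries1.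
  by rewrite /pt1 ffunE /= permM tpermK.
case: (ltnP n (q + q)) => [nqq|qqn].
  have nq : (n - q < q)%N by lia.
  rewrite -(subnKC qn) -[(n - q)%N]/(val (Ordinal nq)) !nth_tqueries2.
  by rewrite /pt2 ffunE /= permM tpermK.
(* Earlier sums belong to tested pairs other than [s], while the exchange moves only [s] and
   untested pairs. *)
have ns : (n - (q + q) < s)%N by lia.
have nm := ltn_trans ns (ltn_ord s).
rewrite -(subnKC qqn) -[(n - (q + q))%N]/(val (Ordinal nm)) -/(pos3 (Ordinal nm)).
have ne : lshift k s != lshift k (Ordinal nm).
  by rewrite (inj_eq (@lshift_inj _ _)) -val_eqE /= gtn_eqF.
have rl (u : 'I_k) : rshift m u != lshift k (Ordinal nm) by rewrite eq_rlshift.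
by rewrite !nth_tqueries3 /pt1 /pt2 !ffunE /= !tpermD.
Qed.

(** Over the [k ^ 2] exchanges the [s]-th sum runs through all sums of untested halves. Without
    collisions these are distinct, and the erased set stays fixed, so at most [t (2q + m)] exchanges
    lose the sum. *)
Lemma late_lost_bound s :
  (#|[set r | ~~ collision r && lost r (pos3 s)]| * (k * k) <=
     t * (q + q + m) * #|tcoins|)%N.
Proof.
have -> : (k * k = #|{: 'I_k * 'I_k}|)%N by rewrite card_prod card_ord.
apply: (averaging_bound (@swap_inj s)) => r.
case: (boolP (collision r)) => [coll|nocoll].
  rewrite (_ : [set w | _] = set0) ?cards0 //.
  by apply/setP=> w; rewrite !inE collision_swap.
have inj : injective (fun w : 'I_k * 'I_k => psum r (rshift m w.1, rshift m w.2)).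
  move=> [u v] [u' v'] /= e; apply: contraNeq nocoll => ne.
  apply/existsP; exists ((rshift m u, rshift m v), (rshift m u', rshift m v')).
  by rewrite /= e eqxx andbT xpair_eqE !(inj_eq (@rshift_inj _ _)).
rewrite -(card_imset _ inj).
have s_le : (pos3 s <= q + q + m)%N by apply: ltnW (pos3_lt s).
apply: (@leq_trans #|erased f adv (take (pos3 s) (tqueries r))|); last first.
  by apply: leq_trans (card_erased_take _ s_le) _; rewrite leq_mul2l s_le orbT.
apply/subset_leq_card/subsetP=> _ /imsetP[w + ->]; rewrite inE => /andP[_].
rewrite /lost take_swap nth_tqueries3.
by have := psum_swap s w r (lshift k s, lshift k s); rewrite !tpermL /psum /= => ->.
Qed.

Lemma late_loss_bound :
  (#|[set r | ~~ collision r && late_loss r]| * (k * k) <=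
     m * (t * (q + q + m) * #|tcoins|))%N.
Proof.
rewrite -[X in (_ <= X * _)%N]card_ord.
rewrite (_ : [set r | _] = [set r | [exists s, ~~ collision r && lost r (pos3 s)]]).
  by apply: union_bound => s; apply: late_lost_bound.
apply/setP=> r; rewrite !inE; apply/andP/existsP => [[nc /existsP[s ls]]|[s /andP[nc ls]]].
  by exists s; rewrite nc.
by split=> //; apply/existsP; exists s.
Qed.

(** * Independence of the tested pairs *)

Lemma no_violation_card :
  (#|[set r | no_violation r]| * (#|{: cube d}| ^ 2) ^ m =
   #|[set p | ~~ violates f p]| ^ m * #|tcoins|)%N.
Proof.
have split_l s : split (lshift k s) = inl s := unsplitK (inl s).
have split_r (u : 'I_k) : split (rshift m u) = inr u := unsplitK (inr u).
(* The event constrains each of the first [m] coordinates separately and leaves the other pairs and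
   both permutations free, so it is a product set. *)
pose good i := if split i is inl _ then [pred p | ~~ violates f p] else predT.
pose A := [set U : {ffun 'I_q -> cube d * cube d} | U \in family good].
have -> : [set r | no_violation r] = setX (setX A setT) setT.
  apply/setP=> -[[U sg] ta]; rewrite !inE !andbT.
  apply/forallP/familyP => [nv i|nv s].
    rewrite /good; case: (split_ordP i) => s ->.
      exact: nv.
    by [].
  by have := nv (lshift k s); rewrite /good split_l.
rewrite !cardsX !cardsT.
have -> : #|A| = (#|[set p | ~~ violates f p]| ^ m * (#|{: cube d}| * #|{: cube d}|) ^ k)%N.
  rewrite cardsE card_family foldrE big_map big_enum /= big_split_ord /= -card_prod.
  have expE (a n : nat) : (a ^ n = \prod_(u < n) a)%N by rewrite prod_nat_const card_ord.
  rewrite !expE; congr (_ * _)%N.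
    apply: eq_big => s; rewrite ?inE // => _; rewrite /good split_l.
    by apply: eq_card => p; rewrite !inE.
  apply: eq_big => u; rewrite ?inE // => _; rewrite /good split_r.
  by apply: eq_card => p; rewrite !inE.
rewrite !card_prod [#|{: {ffun 'I_q -> _}}|]card_ffun card_prod card_ord.
by rewrite -!mulnn !expnD; ring.
Qed.

Lemma card_tcoins_gt0 : (0 < #|tcoins|)%N.
Proof. by apply/card_gt0P; exists ([ffun=> (0, 0)], 1%g, 1%g). Qed.

End Tester.

(** * Soundness and the choice of constants *)

Lemma geometric_le (R : realType) (x : R) n :
  0 <= x <= 1 -> (1 - x) ^+ n * (1 + n%:R * x) <= 1.
Proof.
case/andP=> x0 x1; elim: n => [|n IH]; first by rewrite expr0 mul0r addr0 mul1r.
(* [(1 - x) (1 + (n + 1) x) = 1 + n x - (n + 1) x ^ 2]. *)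
apply: le_trans IH; rewrite exprSr -mulrA ler_wpM2l ?exprn_ge0 //; first lra.
rewrite -natr1; have : 0 <= n%:R * x * x + x * x by rewrite addr_ge0 ?mulr_ge0.
nra.
Qed.

Lemma no_violation_rate (R : realType) d m k (f : cube d -> bool) (eps : R) :
  0 < eps <= 1 -> lin_far eps f -> 9 <= m%:R * eps ->
  #|[set r : tcoins d m k | no_violation f r]|%:R <= 1 / 10 * #|tcoins d m k|%:R :> R.
Proof.
move=> /andP[eps0 eps1] far m9; set a : R := #|_|%:R; set T : R := #|_|%:R.
have T0 : 0 <= T by [].
have := card_cube_gt0 R d; set N : R := #|_|%:R => N0.
pose nv : R := #|[set p | ~~ violates f p]|%:R.
have nv_le : nv <= (1 - eps) * N ^+ 2.
  have := violation_rate far; rewrite -/N.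
  suff : nv = N ^+ 2 - #|[set p | violates f p]|%:R by move=> ->; lra.
  rewrite expr2 -natrM -card_prod -(cardsC [set p | violates f p]) natrD addrC addKr.
  by congr (_%:R); apply: eq_card => p; rewrite !inE.
have key : a * (N ^+ 2) ^+ m = nv ^+ m * T.
  by rewrite -!natrX -!natrM no_violation_card.
have NN : 0 < (N ^+ 2) ^+ m by rewrite !exprn_gt0.
have a_le : a <= (1 - eps) ^+ m * T.
  rewrite -(ler_pM2r NN) key mulrAC -exprMn ler_wpM2r //.
  by apply: lerXn2r; rewrite ?nnegrE // mulr_ge0 ?subr_ge0 ?sqr_ge0.
apply: le_trans a_le _; rewrite ler_wpM2r //.
have p0 : 0 <= (1 - eps) ^+ m by rewrite exprn_ge0 ?subr_ge0.
(* As [1 + m eps >= 10], this yields [(1 - eps) ^ m <= 1 / 10]. *)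
have := @geometric_le R eps m; rewrite (ltW eps0) eps1 => /(_ isT).
nra.
Qed.

(** For [t > 0] the four failure events contribute [10 + 4 + 1 + 3 = 18] hundredths. The bound on
    the cube is conditional on [0 < t] because at [t = 0] the theorem's condition on [t] carries no
    information about [d]. *)
Lemma tester_sound (R : realType) d m k t (f : cube d -> bool) (adv : adversary d)
    (eps : R) :
  0 < eps <= 1 -> lin_far eps f -> adv_budget t adv ->
  9 <= m%:R * eps -> k = (100 * m * maxn t 1)%N ->
  ((0 < t)%N -> 100 * (m + k)%:R ^+ 4 <= #|{: cube d}|%:R :> R) ->
  acc_prob R (tester d m k) f adv <= 1 / 3.
Proof.
move=> eps01 far advt m9 kE q4.
have := no_violation_rate k eps01 far m9.
set a := [set r | no_violation f r] => a_le.
have T0 : 0 < #|tcoins d m k|%:R :> R by rewrite ltr0n card_tcoins_gt0.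
rewrite /acc_prob ler_pdivrMr //.
set acc := [set r | _].
have acc_sub : acc \subset
    [set r | [|| no_violation f r, early_loss f adv r | late_loss f adv r]].
  by apply/subsetP=> r; rewrite !inE => /tester_accepts.
have m0 : (0 < m)%N.
  by rewrite lt0n; apply/eqP=> m0; move: m9; rewrite m0 mul0r; lra.
(* Without erasures no query is lost, so only [no_violation] remains. *)
case: (posnP t) => [t0|t_gt0].
  have : (#|acc| <= #|a|)%N.
    apply/subset_leq_card/(subset_trans acc_sub)/subsetP=> r; rewrite !inE.
    case/or3P=> // /existsP[n]; rewrite (lost0 f advt) //.
      by rewrite (leq_trans (ltnW (ltn_ord n))) ?leq_addr.
    exact: ltnW (pos3_lt _ _).
  rewrite -(ler_nat R); lra.
set T : R := #|tcoins d m k|%:R in a_le T0 *.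
pose b := [set r : tcoins d m k | early_loss f adv r].
pose c := [set r : tcoins d m k | collision r].
pose e := [set r : tcoins d m k | ~~ collision r && late_loss f adv r].
have acc_le : (#|acc| <= #|a| + #|b| + #|c| + #|e|)%N.
  apply: leq_trans (subset_leq_card acc_sub) _.
  apply: (@leq_trans #|a :|: b :|: c :|: e|).
    apply/subset_leq_card/subsetP=> r; rewrite !inE.
    by case: (no_violation _ _); case: (early_loss _ _ _); case: (collision _).
  by do 3 (apply: leq_trans (leq_card_setU _ _) _; rewrite leq_add2r).
have {acc_le} : #|acc|%:R <= #|a|%:R + #|b|%:R + #|c|%:R + #|e|%:R :> R.
  by rewrite -!natrD ler_nat.
have tE : maxn t 1 = t by lia.
have [t_mt m_mt] : (t <= m * t)%N /\ (m <= m * t)%N by rewrite leq_pmull ?leq_pmulr.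
have {}kE : k = (100 * (m * t))%N by rewrite kE tE mulnA.
move: q4 => /(_ t_gt0); set N : R := #|{: cube d}|%:R; set q := (m + k)%N => q4.
have q1 : 1 <= q%:R :> R by rewrite ler1n addn_gt0 m0.
have N0 : 0 < N := card_cube_gt0 R d.
have t_le_q : (t <= q)%N by rewrite /q; clear -t_mt kE; lia.
(* The rate [4 q ^ 2 t / N] is at most [4 q ^ 4 / N], because [t <= q <= q ^ 2]. *)
have b_le : #|b|%:R <= 4 / 100 * T.
  have := early_loss_bound m k f advt; rewrite -/b -/q -(ler_nat R) !natrM [(q + q)%:R]natrD -/N -/T.
  have : t%:R <= q%:R :> R by rewrite ler_nat.
  move=> tq bN; rewrite -(ler_pM2r N0); apply: le_trans bN _.
  have -> : (q%:R + q%:R) * (t%:R * (q%:R + q%:R) * T) = (4 * q%:R ^+ 2 * t%:R) * T :> R.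
    ring.
  rewrite [leRHS]mulrAC ler_wpM2r ?(ltW T0) //.
  apply: (@le_trans _ _ (4 * q%:R ^+ 4)); last by lra.
  rewrite -mulrA ler_wpM2l // -[4%N]/(2 + 2)%N exprD ler_wpM2l ?sqr_ge0 //.
  by rewrite expr2 -[t%:R]mul1r ler_pM.
have c_le : #|c|%:R <= 1 / 100 * T.
  have := collision_bound d m k; rewrite -/c -(ler_nat R) !natrM -/N -/T -/q.
  move=> cN; rewrite -(ler_pM2r N0); apply: le_trans cN _.
  rewrite [leRHS]mulrAC ler_wpM2r ?(ltW T0) //.
  have -> : q%:R * q%:R * (q%:R * q%:R) = q%:R ^+ 4 :> R by ring.
  by lra.
have e_le : #|e|%:R <= 3 / 100 * T.
  have := late_loss_bound m k f advt; rewrite -/e -(ler_nat R) !natrM -/T.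
  have k0 : 0 < k%:R :> R by rewrite ltr0n; clear -t_mt t_gt0 kE; lia.
  move=> ek; rewrite -(ler_pM2r (mulr_gt0 k0 k0)); apply: le_trans ek _.
  rewrite mulrA [leRHS]mulrAC ler_wpM2r ?(ltW T0) //.
  (* Here [m t = k / 100] and [2 q + m = 3 m + 2 k <= 3 k], whence [3 / 100]. *)
  have -> : k%:R * k%:R = 100 * (m%:R * t%:R) * k%:R :> R.
    by rewrite {1}kE !natrM.
  have : (m + k + (m + k) + m <= 3 * k)%N by clear -m_mt kE; lia.
  rewrite -(ler_nat R) natrM => len.
  rewrite mulrA [leRHS](_ : _ = m%:R * t%:R * (3 * k%:R)); last by field.
  by rewrite ler_wpM2l ?mulr_ge0.
lra.
Qed.

Theorem theoremB1 (R : realType) :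
  exists c0 : R, 0 < c0 < 1 /\
  exists C : R, 0 < C /\
  forall (d t : nat) (eps : R), 0 < eps ->
    t%:R <= c0 * eps * (2 `^ (d%:R / 4)) ->
    exists A : na_algo d,
      (nq A)%:R <= C * (maxn t 1)%:R / eps /\ oe_lin_tester_1sided t eps A.
Proof.
(* With [h = 2 ^ (d / 4)] and [t > 0], this gives [m t <= 10 h / 10000], so
   [q <= 101 m t <= 101 h / 1000] and [100 q ^ 4 <= h ^ 4], the size of the cube. *)
exists (1 / 10000); split; first by lra.
(* From [2 q + m <= 203 m max(t, 1)] and [m eps <= 10]. *)
exists 2030; split; first by lra.
move=> d t eps eps0 t_le.
have complete m k (f : cube d -> bool) : is_linear f -> forall adv,
    adv_budget t adv -> acc_prob R (tester d m k) f adv = 1.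
  move=> flin adv advt; rewrite /acc_prob.
  rewrite (_ : [set r | _] = [set: coins (tester d m k)]); last first.
    by apply/setP=> r; rewrite !inE tester_complete.
  by rewrite cardsT divff // pnatr_eq0 -lt0n card_tcoins_gt0.
have N0 := card_cube_gt0 R d.
(* For [eps > 1] no function is [eps]-far, since the zero function is at relative distance at most
   1; a tester with no queries suffices. *)
case: (leP eps 1) => eps1; last first.
  exists (tester d 0 0); split=> /=.
    by rewrite divr_ge0 ?mulr_ge0 ?(ltW eps0).
  split=> [|f far]; first exact: complete.
  have /far : @is_linear d (fun=> false) by exists set0 => x; rewrite big_set0.
  rewrite ler_pdivlMr // => H; exfalso.
  have : #|[set x : cube d | f x != false]|%:R <= #|{: cube d}|%:R :> R.
    by rewrite ler_nat max_card.
  nra.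
(* The witness is one more than the integer part of [9 / eps]; then [m eps <= 9 + eps <= 10]. *)
have [m m9 m10] : exists2 m : nat, 9 <= m%:R * eps & m%:R * eps <= 10.
  have e9 : 0 <= 9 / eps by rewrite divr_ge0 // ltW.
  exists (Num.truncn (9 / eps)).+1; first by rewrite -ler_pdivrMr // ltW // truncnS_gt.
  have : (Num.truncn (9 / eps)).+1%:R <= 9 / eps + 1 :> R.
    by rewrite -[_.+1%:R]natr1 lerD2r truncn_le.
  rewrite -(ler_pM2r eps0) [leRHS]mulrDl divfK ?gt_eqF //; lra.
have [k kE] : exists k, k = (100 * m * maxn t 1)%N by eexists.
have m_mt : (m <= m * maxn t 1)%N by rewrite leq_pmulr // leq_maxr.
exists (tester d m k); split=> /=.
  rewrite ler_pdivlMr //.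
  have : (m + k + (m + k) + m <= 203 * (m * maxn t 1))%N by clear -m_mt kE; lia.
  rewrite -(ler_nat R) !natrM => le.
  apply: (@le_trans _ _ (203 * (m%:R * (maxn t 1)%:R) * eps)).
    by rewrite ler_wpM2r // ltW.
  have M0 : 0 <= (maxn t 1)%:R :> R by [].
  nra.
split=> [f|f far adv advt]; first exact: complete.
apply: (tester_sound (t := t) (eps := eps)) => //; first by rewrite eps0.
move=> t0; set h := 2 `^ (d%:R / 4) in t_le.
have h0 : 0 <= h by apply: powR_ge0.
have -> : #|{: cube d}|%:R = h ^+ 4 :> R.
  rewrite card_ffun card_bool card_ord natrX -!powR_mulrn // -powRrM.
  by rewrite divfK ?pnatr_eq0.
have q_le : (m + k)%:R <= 101 / 1000 * h.
  have : (m + k <= 101 * (m * t))%N.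
    by clear -m_mt kE t0; rewrite (_ : maxn t 1 = t) in m_mt kE; lia.
  rewrite -(ler_nat R) !natrM => le; apply: (le_trans le).
  have : m%:R * t%:R <= m%:R * eps * (1 / 10000 * h) :> R.
    by rewrite -mulrA ler_wpM2l // mulrCA mulrA.
  nra.
apply: (@le_trans _ _ (100 * (101 / 1000 * h) ^+ 4)).
  rewrite ler_pM2l // lerXn2r // nnegrE //; lra.
rewrite exprMn mulrA -[leRHS]mul1r ler_wpM2r ?exprn_ge0 //; lra.
Qed.
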